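(* There is a universal constant $C>0$ such that for every $\epsilon>0$ there exists $N_\epsilon$ such that for all integers $n\ge N_\epsilon$ and all integers $k\ge(1+\epsilon)\log_2 n$, $$|E_{n,k}-1|\le C\,n^{-2\epsilon},$$ where $E_{n,k}$ is the maximum, over all no-feedback guessing strategies, of the expected number of cards guessed correctly in a deck of $n$ cards that has been shuffled $k$ times with a single-shelf shuffler.
   Context: Single-shelf shuffle: the cards of the current deck are drawn one at a time from the bottom, and each drawn card is placed, independently with probability $1/2$ each, on the top or at the bottom of the pile on the single shelf; the resulting pile is the new deck. The probability that the card at position $i$ (position $1$ is the top) moves to position $j$ in one shuffle is $$M(i,j)=\frac{1}{2^i}\left(\binom{i-1}{j-1}+\binom{i-1}{n-j}\right),\qquad 1\le i,j\le n,$$ with $\binom{0}{0}=1$ and $\binom{a}{b}=0$ for $a<b$. The deck starts in increasing order $1,\dots,n$ (card $i$ at position $i$), and the $k$ shuffles are independent, so card $i$ is at position $j$ after $k$ shuffles with probability $M^k(i,j)$. No-feedback guessing: the player chooses for each position $j$ a card $g_j\in\{1,\dots,n\}$ (repetitions allowed), receiving no information during the game; the guess at $j$ is correct if the card at position $j$ is $g_j$. Thus $E_{n,k}=\sum_{j=1}^n\max_{1\le i\le n}M^k(i,j)$. *)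

(* Defs.v *)
From HB Require Import structures.
From mathcomp Require Import all_boot all_order all_algebra.
From mathcomp Require Import all_classical all_reals all_analysis.

Set Implicit Arguments.
Unset Strict Implicit.
Unset Printing Implicit Defensive.

Import Order.TTheory GRing.Theory Num.Theory.
Local Open Scope ring_scope.

(* A deck (or a pile) is the sequence of its cards read from top to bottom.
   The n cards and the n positions are both numbered 0, ..., n-1, position 0
   being the top. *)

Definition place (T : Type) (pile : seq T) (cb : T * bool) : seq T :=
  if cb.2 then cb.1 :: pile else rcons pile cb.1.

(* The i-th coin decides where the i-th card drawn goes: true for the top of the
   pile, false for its bottom. Cards are drawn from the bottom of the deck, hence
   the reversal. *)
Definition shelf_shuffle (T : Type) (deck : seq T) (coins : seq bool) : seq T :=
  foldl (@place T) [::] (zip (rev deck) coins).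

(* All the coin flips made during k shuffles of n cards. The flips are fair and
   independent, i.e. uniformly distributed over this finite type. *)
Definition flips (n k : nat) : finType := k.-tuple (n.-tuple bool).

Definition shuffled_deck (n k : nat) (w : flips n k) : seq 'I_n :=
  foldl (fun deck (coins : n.-tuple bool) => shelf_shuffle deck coins)
    (enum 'I_n) w.

(* A no-feedback strategy announces the card g j at every position j. *)
Definition strategy (n : nat) : finType := {ffun 'I_n -> 'I_n}.

Definition num_correct (n : nat) (deck : seq 'I_n) (g : strategy n) : nat :=
  #|[set j : 'I_n | onth deck j == Some (g j)]|.

Definition expected_correct (R : realType) (n k : nat) (g : strategy n) : R :=
  (\sum_(w : flips n k) (num_correct (shuffled_deck w) g)%:R) / #|flips n k|%:R.

(* Expectations are nonnegative and the set of strategies is never empty, so the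
   initial value 0 does not affect the maximum. *)
Definition max_expected_correct (R : realType) (n k : nat) : R :=
  \big[Num.max/0]_(g : strategy n) expected_correct R k g.

Definition log2 (R : realType) (x : R) : R := ln x / ln 2.

(* Main.v *)
(* Number positions from 0 and let u = (1 + X) / 2. The position of card i after
   one shuffle has generating function r_n(i) = u^i (1 + X^(n-1-i)) / 2: card i
   lands on top of the pile or below its n-1-i cards, and each of the i cards
   drawn later moves it down with probability 1/2. Let M_n be the transition
   matrix, with rows r_n(i), and D the second difference operator on rows. Then
   D M_(n+2) = (1/4) M_n D, hence D M_(n+2)^k = 4^(-k) M_n^k D, whose rows have l1
   norm at most 4 * 4^(-k) because M_n is stochastic. For k >= 1 the last two rows
   of M^k coincide, so every row differs from the last one by sums of at most n^2
   second differences, and summing over the columns bounds the expected score of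
   any strategy by 1 + 4 n^2 / 4^k. A constant guess scores exactly 1. *)

Require Import Defs.
From HB Require Import structures.
From mathcomp Require Import all_boot all_order all_algebra.
From mathcomp Require Import all_classical all_reals all_analysis.
From mathcomp Require Import ring lra zify.

Set Implicit Arguments.
Unset Strict Implicit.
Unset Printing Implicit Defensive.

Import Order.TTheory GRing.Theory Num.Theory.
Local Open Scope ring_scope.

(** * Sums over coin tuples; a shuffle permutes the deck *)

Lemma big_tuple_cons (V : nmodType) (T : finType) (n : nat)
    (F : n.+1.-tuple T -> V) :
  \sum_(t : n.+1.-tuple T) F t
    = \sum_(x : T) \sum_(t : n.-tuple T) F [tuple of x :: t].
Proof.
rewrite pair_big /=.
rewrite (reindex (fun p : T * n.-tuple T => [tuple of p.1 :: p.2])) //=.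
exists (fun t => (thead t, [tuple of behead t])) => [[x t] _|t _] /=.
  by congr pair; apply: val_inj.
by rewrite [RHS]tuple_eta; apply: val_inj.
Qed.

Lemma big_tuple0 (V : nmodType) (T : finType) (F : 0.-tuple T -> V) :
  \sum_(t : 0.-tuple T) F t = F [tuple].
Proof.
by rewrite (big_pred1 [tuple]) // => t; apply/esym/eqP; rewrite tuple0.
Qed.

Lemma perm_place (T : eqType) (pile : seq T) (cb : T * bool) :
  perm_eq (place pile cb) (cb.1 :: pile).
Proof. by rewrite /place; case: cb.2; rewrite ?perm_rcons. Qed.

Lemma perm_foldl_place (T : eqType) (s : seq T) (c : seq bool) (pile : seq T) :
  size c = size s -> perm_eq (foldl (@place T) pile (zip s c)) (s ++ pile).
Proof.
elim: s c pile => [|x s IH] [|b c] pile //= [szc].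
apply: perm_trans (IH _ _ szc) _.
rewrite -cat_cons -[x :: s]cat1s -catA perm_sym perm_catCA perm_cat2l.
by rewrite perm_sym; apply: (perm_place _ (x, b)).
Qed.

Lemma perm_shelf_shuffle (T : eqType) (deck : seq T) (c : seq bool) :
  size c = size deck -> perm_eq (shelf_shuffle deck c) deck.
Proof.
move=> szc; rewrite /shelf_shuffle.
apply: perm_trans (perm_foldl_place _ _) _; first by rewrite size_rev.
by rewrite cats0 perm_rev.
Qed.

(** * Generating function of a card's place in the pile *)

Section PositionGeneratingFunctions.
Variable R : fieldType.

(** Once [x] is in the pile, each further card moves it down by one (top) or leaves it in place
    (bottom), so every coin contributes a factor 1 + X. *)
Lemma sum_index_placed (T : eqType) (n : nat) (x : T) (s pile : seq T) :
  size s = n -> x \in pile -> x \notin s ->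
  \sum_(c : n.-tuple bool) 'X^(index x (foldl (@place T) pile (zip s c)))
    = 'X^(index x pile) * (1 + 'X) ^+ n :> {poly R}.
Proof.
elim: s n pile => [|y s IH] [|n] //= pile.
  by move=> *; rewrite big_tuple0 /= expr0 mulr1.
move=> [szs] xp; rewrite inE negb_or => /andP[xy xs].
have xplace b : x \in place pile (y, b).
  by rewrite (perm_mem (perm_place _ _)) inE xp orbT.
rewrite big_tuple_cons big_bool /= !IH //.
rewrite /place /= eq_sym (negPf xy) -cats1 index_cat xp !exprS; ring.
Qed.

(** Cards drawn before [x] have irrelevant coins, a factor 2 each. Then [x] enters at index 0 or
    below all cards already placed, and the remaining coins act as in [sum_index_placed]. *)
Lemma sum_index_drawn (T : eqType) (n : nat) (x : T) (s pile : seq T) :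
  size s = n -> x \in s -> uniq (s ++ pile) ->
  \sum_(c : n.-tuple bool) 'X^(index x (foldl (@place T) pile (zip s c)))
    = 2 ^+ index x s * (1 + 'X^(size pile + index x s))
      * (1 + 'X) ^+ (n - (index x s).+1) :> {poly R}.
Proof.
elim: s n pile => [|y s IH] [|n] //= pile [szs].
rewrite inE mem_cat negb_or => xs /andP[/andP[ys yp] us].
rewrite big_tuple_cons big_bool /=.
have [yx|yx] := eqVneq y x.
  subst y; have xplace b : x \in place pile (x, b).
    by rewrite (perm_mem (perm_place _ _)) mem_head.
  rewrite !sum_index_placed //.
  by rewrite /place /= eqxx -cats1 index_cat (negPf yp) /= eqxx subn1 addn0; ring.
have {}xs : x \in s by move: xs; rewrite eq_sym (negPf yx).
have ul b : uniq (s ++ place pile (y, b)).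
  rewrite (perm_uniq (perm_cat (perm_refl s) (perm_place _ _))) /=.
  by rewrite uniq_catC /= mem_cat negb_or yp ys uniq_catC.
rewrite !IH //.
rewrite /place /= size_rcons subSS addSnnS !exprS; ring.
Qed.
End PositionGeneratingFunctions.

(** * The transition matrix and its rows as polynomials *)

Section TransitionMatrix.
Variable R : realType.

(** For i < n the coefficient of X^j, j < n, is 2^-(i+1) (C(i, j) + C(i, n-1-j)): the probability
    M(i+1, j+1) in positions counted from 1. *)
Definition position_gf (n i : nat) : {poly R} :=
  2^-1 *: ((2^-1 *: (1 + 'X)) ^+ i * (1 + 'X^(n - i.+1))).

(** The degree is at most i + (n-1-i) = n-1, so the n entries of a matrix row hold the whole
    polynomial. *)
Lemma size_position_gf (n i : nat) : (i < n)%N -> (size (position_gf n i) <= n)%N.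
Proof.
move=> ltin; rewrite /position_gf; apply: leq_trans (size_scale_leq _ _) _.
rewrite exprZn -scalerAl; apply: leq_trans (size_scale_leq _ _) _.
apply: leq_trans (size_polyMleq _ _) _.
have s1 : (size ((1 + 'X : {poly R}) ^+ i) <= i.+1)%N.
  apply: leq_trans (size_poly_exp_leq _ _) _.
  by rewrite addrC -[1]polyC1 size_XaddC /= mul1n.
have s2 : (size (1 + 'X^(n - i.+1) : {poly R})%R <= (n - i.+1).+1)%N.
  by apply: leq_trans (size_polyD _ _) _; rewrite size_poly1 size_polyXn; lia.
by rewrite -subn1; apply: leq_trans (leq_sub2r 1 (leq_add s1 s2)) _; lia.
Qed.

Lemma position_gf_ge0 (n i j : nat) : 0 <= (position_gf n i)`_j.
Proof.
suff : position_gf n i \is a polyOver Num.nneg.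
  by move=> /polyOverP /(_ j); rewrite nnegrE.
have h : (2^-1 : R) \is Num.nneg by rewrite nnegrE invr_ge0 ler0n.
apply: polyOverZ => //; apply: rpredM.
  by apply: rpredX; apply: polyOverZ => //; rewrite rpredD ?rpred1 ?polyOverX.
by rewrite rpredD ?rpred1 ?rpredX ?polyOverX.
Qed.

Lemma position_gf_sum (n i : nat) :
  (i < n)%N -> \sum_(j < n) (position_gf n i)`_j = 1.
Proof.
(* The row sum is the value at X = 1, where u = 1. *)
move=> ltin; have := horner_coef_wide 1 (size_position_gf ltin).
under eq_bigr do rewrite expr1n mulr1.
move=> <-; rewrite /position_gf !(hornerZ, hornerM, horner_exp, hornerD, hornerXn).
rewrite hornerC hornerX expr1n.
have -> : 2^-1 * (1 + 1) = 1 :> R by field.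
by rewrite expr1n; field.
Qed.

(* The source of the contraction factor 1/4: with u = (1 + X) / 2, one has
   u - 1 = (X - 1) / 2 and u - X = (1 - X) / 2. *)
Lemma position_gf_second_difference (n i : nat) : (i < n)%N ->
  position_gf n.+2 i - 2 *: position_gf n.+2 i.+1 + position_gf n.+2 i.+2
    = 4^-1 *: ((1 - 'X) ^+ 2 * position_gf n i).
Proof.
move=> ltin; rewrite /position_gf.
have -> : (n.+2 - i.+1 = (n - i.+1).+2)%N by lia.
have -> : (n.+2 - i.+2 = (n - i.+1).+1)%N by lia.
have -> : (n.+2 - i.+3 = n - i.+1)%N by lia.
have -> : 4^-1 = 2^-1 * 2^-1 :> R by field.
have /(congr1 (@polyC R)) : 2 * 2^-1 = 1 :> R by field.
rewrite -!mul_polyC !exprS !polyCM polyC1.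
move: (2^-1)%:P => h; rewrite polyC_natr => h2.
set u := h * (1 + 'X); set U := u ^+ i.
have eX : 'X = 2 * u - 1 by rewrite /u mulrA h2; ring.
have eh : h * (1 - 'X) = 1 - u.
  by rewrite eX; transitivity (2 * h * (1 - u)); [ring | rewrite h2 mul1r].
transitivity ((h * (1 - 'X)) ^+ 2 * (h * (U * (1 + 'X^(n - i.+1))))); last ring.
by rewrite eh; move: ('X^(n - i.+1)) => Z; rewrite eX; ring.
Qed.

(** The two bottom cards are drawn first and the second lands above or below the first with equal
    probability, so they are exchangeable: both polynomials equal u^(n+1). *)
Lemma position_gf_last_two (n : nat) : position_gf n.+2 n.+1 = position_gf n.+2 n.
Proof.
rewrite /position_gf subnn subSnn expr0 expr1 exprS; congr (_ *: _).
rewrite -!scalerAl; set p := _ ^+ n.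
transitivity ((2^-1 * 2) *: (p * (1 + 'X))); last first.
  by rewrite mulVf ?pnatr_eq0 ?scale1r.
by rewrite -scalerA; congr (_ *: _); rewrite scaler_nat; ring.
Qed.

Definition shuffle_mx (n : nat) : 'M[R]_n :=
  \matrix_(i, j) (position_gf n i)`_j.

Definition shuffles_mx (n k : nat) : 'M[R]_n := iter k (mulmx (shuffle_mx n)) 1%:M.

Lemma shuffles_mxS (n k : nat) :
  shuffles_mx n k.+1 = shuffle_mx n *m shuffles_mx n k.
Proof. by []. Qed.

Lemma shuffles_mx_ge0 (n k : nat) (i j : 'I_n) : 0 <= shuffles_mx n k i j.
Proof.
elim: k i => [|k IH] i; first by rewrite !mxE ler0n.
by rewrite mxE sumr_ge0 // => l _; rewrite mulr_ge0 // mxE position_gf_ge0.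
Qed.

Lemma shuffles_mx_sum (n k : nat) (i : 'I_n) : \sum_j shuffles_mx n k i j = 1.
Proof.
elim: k i => [|k IH] i.
  rewrite (bigD1 i) //= big1 => [|j /negPf ji]; rewrite !mxE ?eqxx ?addr0 //.
  by rewrite eq_sym ji.
under eq_bigr do rewrite mxE.
rewrite exchange_big /=.
under eq_bigr do rewrite -mulr_sumr IH mulr1 mxE.
by rewrite position_gf_sum.
Qed.

(** * Second differences of rows and their contraction *)

Definition second_difference_mx (n : nat) : 'M[R]_(n, n.+2) :=
  \matrix_(i, j) ((1 - 'X) ^+ 2 * 'X^i)`_j.

Lemma second_difference_mxE (n : nat) (i : 'I_n) (j : 'I_n.+2) :
  second_difference_mx n i j
    = (j == i :> nat)%:R - 2 * (j == i.+1 :> nat)%:R + (j == i.+2 :> nat)%:R.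
Proof.
rewrite mxE; have -> : (1 - 'X) ^+ 2 * 'X^i
    = 'X^i - (2 : R) *: 'X^(i.+1) + 'X^(i.+2) :> {poly R}.
  by rewrite -mul_polyC polyC_natr !exprS; ring.
by rewrite !coefE.
Qed.

Lemma mul_second_difference_mx (n p : nat) (A : 'M[R]_(n.+2, p)) (i : 'I_n) j :
  (second_difference_mx n *m A) i j
    = A (inord i) j - 2 * A (inord i.+1) j + A (inord i.+2) j.
Proof.
have pick q : (q < n.+2)%N ->
    \sum_(l < n.+2) (l == q :> nat)%:R * A l j = A (inord q) j.
  move=> ltq; rewrite (bigD1 (inord q)) //= inordK // eqxx mul1r big1 ?addr0 //.
  move=> l lq; have /negPf -> : l != q :> nat.
    by apply: contraNneq lq => <-; rewrite inord_val.
  by rewrite mul0r.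
have lti := ltn_ord i; rewrite mxE -!pick; [|lia..].
rewrite mulr_sumr -sumrB -big_split /=; apply: eq_bigr => l _.
by rewrite second_difference_mxE; ring.
Qed.

Lemma second_difference_mx_norm (n : nat) (i : 'I_n) :
  \sum_j `|second_difference_mx n i j| <= 4.
Proof.
have pick q : (q < n.+2)%N -> \sum_(l < n.+2) (l == q :> nat)%:R = 1 :> R.
  move=> ltq; rewrite (bigD1 (inord q)) //= inordK // eqxx big1 ?addr0 //.
  move=> l lq; have /negPf -> : l != q :> nat; last by [].
  by apply: contraNneq lq => <-; rewrite inord_val.
have lti := ltn_ord i.
have -> : 4 = \sum_(j < n.+2) ((j == i :> nat)%:R + 2 * (j == i.+1 :> nat)%:R
              + (j == i.+2 :> nat)%:R) :> R.
  by rewrite !big_split /= -mulr_sumr !pick; [ring|lia..].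
apply: ler_sum => j _; rewrite second_difference_mxE.
apply: le_trans (ler_normD _ _) _.
rewrite [X in _ + X]ger0_norm ?ler0n // lerD2r.
by apply: le_trans (ler_normB _ _) _; rewrite !ger0_norm ?mulr_ge0 ?ler0n.
Qed.

(** The matrix [second_difference_mx] has two readings: multiplying on its right by [A] takes second
    differences of the rows of [A], while multiplying on its left by [A] multiplies the row
    polynomials of [A] by (1 - X)^2. The polynomial identity links the two. *)
Lemma second_difference_shuffle (n : nat) :
  second_difference_mx n *m shuffle_mx n.+2
    = 4^-1 *: (shuffle_mx n *m second_difference_mx n).
Proof.
apply/matrixP => i j; have lti := ltn_ord i.
rewrite mul_second_difference_mx ![in LHS]mxE !inordK; [|lia..].
rewrite -[_ * _]coefZ -coefB -coefD position_gf_second_difference // coefZ mxE.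
congr (_ * _); rewrite mxE.
have -> : position_gf n i = \sum_(l < n) (position_gf n i)`_l *: 'X^l.
  rewrite -poly_def; apply/polyP => l; rewrite coef_poly; case: ltnP => // lel.
  by rewrite nth_default // (leq_trans (size_position_gf lti)).
rewrite mulr_sumr coef_sum; apply: eq_bigr => l _.
by rewrite -scalerAr coefZ !mxE.
Qed.

Lemma second_difference_shuffles (n k : nat) :
  second_difference_mx n *m shuffles_mx n.+2 k
    = 4^-1 ^+ k *: (shuffles_mx n k *m second_difference_mx n).
Proof.
elim: k => [|k IH]; first by rewrite mul1mx mulmx1 scale1r.
rewrite !shuffles_mxS mulmxA second_difference_shuffle -scalemxAl -mulmxA IH.
by rewrite -scalemxAr scalerA exprS mulmxA.
Qed.

Lemma second_difference_shuffles_norm (n k : nat) (i : 'I_n) :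
  \sum_j `|(second_difference_mx n *m shuffles_mx n.+2 k) i j| <= 4 * 4^-1 ^+ k.
Proof.
rewrite second_difference_shuffles.
have c0 : 0 <= 4^-1 ^+ k :> R by rewrite exprn_ge0 // invr_ge0 ler0n.
under eq_bigr do rewrite mxE normrM (ger0_norm c0).
rewrite -mulr_sumr mulrC ler_wpM2r //.
(* Rows of [shuffles_mx n k] are probability vectors, so averaging rows of l1 norm at most 4 keeps
   that bound. *)
apply: (@le_trans _ _ (\sum_j \sum_l
    shuffles_mx n k i l * `|second_difference_mx n l j|)).
  apply: ler_sum => j _; rewrite mxE; apply: le_trans (ler_norm_sum _ _ _) _.
  by apply: ler_sum => l _; rewrite normrM ger0_norm ?shuffles_mx_ge0.
rewrite exchange_big /=.
under eq_bigr do rewrite -mulr_sumr.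
rewrite -[leRHS]mul1r -[X in X * _](shuffles_mx_sum k i) mulr_suml.
apply: ler_sum => l _; apply: ler_wpM2l; first exact: shuffles_mx_ge0.
exact: second_difference_mx_norm.
Qed.

(** The last first difference vanishes, so every first difference is a tail sum of second
    differences; the distance to the end then telescopes over at most n+1 first differences. *)
Lemma dist_last_le_second_differences (n : nat) (a : nat -> R) (i : nat) :
  a n.+1 = a n -> (i <= n.+1)%N ->
  `|a i - a n.+1| <= n.+1%:R * \sum_(q < n) `|a q - 2 * a q.+1 + a q.+2|.
Proof.
move=> an lein; set S := \sum_(q < n) _.
(* Here [t] counts steps back from the vanishing difference at [n]. *)
have step t : (t <= n)%N -> `|a (n - t)%N - a (n - t).+1|
    <= \sum_(n - t <= q < n) `|a q - 2 * a q.+1 + a q.+2|.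
  elim: t => [|t IH] let_; first by rewrite subn0 an subrr normr0 big_geq.
  have e : (n - t = (n - t.+1).+1)%N by lia.
  rewrite big_ltn; last by lia.
  rewrite -e; apply: le_trans (lerD (lexx _) (IH (ltnW let_))).
  apply: le_trans (ler_normD _ _); rewrite e.
  by rewrite le_eqVlt; apply/orP; left; apply/eqP; congr (`|_|); ring.
have S_ge0 : 0 <= S by apply: sumr_ge0.
have stepS p : (p <= n)%N -> `|a p - a p.+1| <= S.
  move=> lepn; have := step (n - p)%N (leq_subr _ _); rewrite subKn // => h.
  apply: le_trans h _; rewrite /S -(big_mkord xpredT
    (fun q => `|a q - 2 * a q.+1 + a q.+2|)) (big_cat_nat (leq0n p) lepn) //=.
  by rewrite lerDr sumr_ge0.
rewrite distrC -telescope_sumr //; apply: le_trans (ler_norm_sum _ _ _) _.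
apply: (@le_trans _ _ (\sum_(i <= p < n.+1) S)).
  rewrite big_nat [leRHS]big_nat; apply: ler_sum => p /andP[_ ltp].
  by rewrite distrC stepS.
rewrite sumr_const_nat -[_ *+ _]mulr_natl ler_wpM2r // ler_nat; lia.
Qed.

Lemma shuffles_mx_best_guess (n k : nat) (g : 'I_n.+2 -> 'I_n.+2) :
  (0 < k)%N ->
  \sum_j shuffles_mx n.+2 k (g j) j <= 1 + 4 * n.+2%:R ^+ 2 * 4^-1 ^+ k.
Proof.
(* At least one shuffle is required: the last two rows agree through the leftmost factor of [A], and
   those of the identity differ. *)
case: k => // k _; set A := shuffles_mx n.+2 k.+1.
have lastE j : A (inord n.+1) j = A (inord n) j.
  rewrite /A shuffles_mxS !mxE; apply: eq_bigr => l _.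
  by rewrite !mxE !inordK // position_gf_last_two.
(* The bound is free of [i], so the guess no longer matters: summed over [j], the last row gives 1
   and the rest is the error. *)
have entry i j : A i j <= A (inord n.+1) j
    + n.+1%:R * \sum_(q < n) `|(second_difference_mx n *m A) q j|.
  rewrite -lerBlDl; apply: le_trans (ler_norm _) _.
  have := dist_last_le_second_differences (a := fun i => A (inord i) j)
    (lastE j) (ltn_ord i : (i <= n.+1)%N).
  rewrite inord_val; under eq_bigr do rewrite -mul_second_difference_mx.
  by [].
apply: (@le_trans _ _ (\sum_j (A (inord n.+1) j
    + n.+1%:R * \sum_(q < n) `|(second_difference_mx n *m A) q j|))).
  by apply: ler_sum => j _; apply: entry.
rewrite big_split /= shuffles_mx_sum lerD2l -mulr_sumr exchange_big /=.
apply: (@le_trans _ _ (n.+1%:R * \sum_(q < n) (4 * 4^-1 ^+ k.+1))).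
  rewrite ler_wpM2l // ler_sum // => q _.
  exact: second_difference_shuffles_norm.
rewrite sumr_const card_ord -[_ *+ n]mulr_natl !mulrA.
apply: ler_wpM2r; first by rewrite exprn_ge0 // invr_ge0 ler0n.
rewrite -!natrM ler_nat; nia.
Qed.
End TransitionMatrix.

(** * From coin counts to powers of the transition matrix *)

Section ShuffledPositions.
Variable R : realType.

Lemma sum_index_shelf_shuffle (T : eqType) (n : nat) (deck : seq T) (x : T)
    (j : nat) :
  size deck = n -> uniq deck -> x \in deck ->
  \sum_(c : n.-tuple bool) (index x (shelf_shuffle deck c) == j)%:R
    = 2 ^+ n * (position_gf R n (index x deck))`_j.
Proof.
move=> szd ud xd.
have ltxn : (index x deck < n)%N by rewrite -szd index_mem.
have xr : x \in rev deck by rewrite mem_rev.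
(* Drawing from the bottom reverses indices: n-1-i cards precede the card at index i, and i cards
   follow it. *)
have er : index x (rev deck) = (n - (index x deck).+1)%N.
  rewrite -{1}(nth_index x xd) -{1}[index x deck](@subKn _ n.-1); last by lia.
  have -> : (n.-1 - (n.-1 - index x deck) = n - (n - (index x deck).+1).+1)%N.
    by lia.
  rewrite -{1}szd -nth_rev; last by lia.
  by rewrite index_uniq ?size_rev ?rev_uniq //; lia.
have ur : uniq (rev deck ++ [::]) by rewrite cats0 rev_uniq.
have := sum_index_drawn R (etrans (size_rev deck) szd) xr ur.
move=> /(congr1 (fun p : {poly R} => p`_j)); rewrite coef_sum => h.
transitivity (\sum_(c : n.-tuple bool)
    ('X^(index x (foldl (@place T) [::] (zip (rev deck) c))) : {poly R})`_j).
  by apply: eq_bigr => c _; rewrite coefXn eq_sym.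
rewrite h er add0n -coefZ /position_gf; congr (_`_j).
have -> : (n - (n - (index x deck).+1).+1 = index x deck)%N by lia.
set i := index x deck in ltxn *; set a := (n - i.+1)%N.
have en : n = (a + i).+1 by lia.
rewrite exprZn -scalerAl !scalerA en exprS exprD.
have -> : 2 * (2 ^+ a * 2 ^+ i) * 2^-1 * 2^-1 ^+ i = 2 ^+ a :> R.
  by rewrite exprVn; field; rewrite expf_neq0 ?pnatr_eq0.
by rewrite -mul_polyC rmorphXn /= polyC_natr -mulrA [(1 + 'X^a) * _]mulrC.
Qed.

(** Markov property: after the first shuffle only the position of [x] matters. The deck is arbitrary
    so that the induction can restart from the shuffled one. *)
Lemma sum_index_shuffles (T : eqType) (n k : nat) (deck : seq T) (x : T)
    (i j : 'I_n) :
  size deck = n -> uniq deck -> x \in deck -> index x deck = i ->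
  \sum_(w : k.-tuple (n.-tuple bool))
      (index x (foldl (fun d (c : n.-tuple bool) => shelf_shuffle d c) deck w)
         == j :> nat)%:R
    = (2 ^+ n) ^+ k * shuffles_mx R n k i j.
Proof.
elim: k deck i => [|k IH] deck i szd ud xd ei.
  by rewrite big_tuple0 /= !mxE expr0 mul1r ei.
rewrite big_tuple_cons shuffles_mxS.
have shuf (c : n.-tuple bool) : perm_eq (shelf_shuffle deck c) deck.
  by apply: perm_shelf_shuffle; rewrite size_tuple.
(* Condition on the position [l] of [x] after the first shuffle. *)
transitivity (\sum_(c : n.-tuple bool) \sum_(l < n)
    (2 ^+ n) ^+ k * ((index x (shelf_shuffle deck c) == l :> nat)%:R
      * shuffles_mx R n k l j)).
  apply: eq_bigr => c _.
  have szc : size (shelf_shuffle deck c) = n by rewrite (perm_size (shuf c)).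
  have xc : x \in shelf_shuffle deck c by rewrite (perm_mem (shuf c)).
  have ltx : (index x (shelf_shuffle deck c) < n)%N by rewrite -[ltnRHS]szc index_mem.
  rewrite [LHS](IH _ (Ordinal ltx)) //; last by rewrite (perm_uniq (shuf c)).
  rewrite (bigD1 (Ordinal ltx)) //= eqxx mul1r big1 ?addr0 // => l.
  by rewrite -val_eqE eq_sym /= => /negPf ->; rewrite mul0r mulr0.
rewrite exchange_big mxE mulr_sumr; apply: eq_bigr => l _.
rewrite -mulr_sumr -mulr_suml sum_index_shelf_shuffle // !mxE ei exprS; ring.
Qed.

End ShuffledPositions.

(** * Expected scores of strategies *)

Lemma perm_shuffled_deck (n k : nat) (w : flips n k) :
  perm_eq (shuffled_deck w) (enum 'I_n).
Proof.
rewrite /shuffled_deck; move: (enum 'I_n) (size_enum_ord n) => d.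
elim: (tval w) d => [|c s IH] d szd //=.
have p : perm_eq (shelf_shuffle d c) d.
  by apply: perm_shelf_shuffle; rewrite size_tuple szd.
by apply: (perm_trans _ p); apply: IH; rewrite (perm_size p).
Qed.

(** Each card occurs exactly once, so a guess at [j] is right exactly when the guessed card has
    index [j]; the score becomes a sum over positions of guessed cards. *)
Lemma num_correctE (n k : nat) (w : flips n k) (g : strategy n) :
  num_correct (shuffled_deck w) g
    = (\sum_(j < n) (index (g j) (shuffled_deck w) == j :> nat))%N.
Proof.
have p := perm_shuffled_deck w; move: (shuffled_deck w) p => d p.
have szd : size d = n by rewrite (perm_size p) size_enum_ord.
have ud : uniq d by rewrite (perm_uniq p) enum_uniq.
have gd j : g j \in d by rewrite (perm_mem p) mem_enum.
rewrite /num_correct -sum1_card big_mkcond /=; apply: eq_bigr => j _.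
rewrite inE onthE (nth_map (g j)) ?szd //.
have -> : (Some (nth (g j) d j) == Some (g j)) = (index (g j) d == j :> nat).
  apply/eqP/eqP => [[e]|<-]; last by rewrite nth_index.
  by rewrite -{1}e index_uniq // szd.
by case: eqP.
Qed.

Lemma expected_correctE (R : realType) (n k : nat) (g : strategy n) :
  expected_correct R k g = \sum_j shuffles_mx R n k (g j) j.
Proof.
rewrite /expected_correct.
under eq_bigr do rewrite num_correctE natr_sum.
rewrite exchange_big mulr_suml; apply: eq_bigr => j _.
rewrite (@sum_index_shuffles R _ n k _ (g j) (g j) j) ?size_enum_ord
    ?enum_uniq ?mem_enum //;
  last exact: index_enum_ord.
by rewrite !card_tuple card_bool !natrX mulrAC mulfV ?mul1r //
  !expf_neq0 // pnatr_eq0.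
Qed.

Lemma max_expected_correct_ge1 (R : realType) (n k : nat) :
  1 <= max_expected_correct R n.+1 k.
Proof.
apply: le_trans (le_bigmax _ _ [ffun=> ord0]); rewrite expected_correctE.
by under eq_bigr do rewrite ffunE; rewrite shuffles_mx_sum.
Qed.

Lemma max_expected_correct_le (R : realType) (n k : nat) : (0 < k)%N ->
  max_expected_correct R n.+2 k <= 1 + 4 * n.+2%:R ^+ 2 * 4^-1 ^+ k.
Proof.
move=> k0; apply: bigmax_le => [|g _].
  by rewrite addr_ge0 ?mulr_ge0 ?exprn_ge0 ?invr_ge0 ?ler0n.
by rewrite expected_correctE shuffles_mx_best_guess.
Qed.

Theorem theorem3 (R : realType) :
  exists C : R, 0 < C /\
    forall eps : R, 0 < eps ->
      exists N : nat, forall n k : nat, (N <= n)%N ->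
        (1 + eps) * log2 (n%:R : R) <= k%:R ->
        `|max_expected_correct R n k - 1| <= C * n%:R `^ (- 2 * eps).
Proof.
(* C = 4 is the constant of [max_expected_correct_le]. N = 2 suffices for every [eps]: it makes ln n
   positive, which forces k > 0. *)
exists 4; split=> // eps eps0; exists 2 => -[|[|n]] // k _.
have n1 : 1 < n.+2%:R :> R by rewrite ltr1n.
have ln2 : 0 < ln 2 :> R by rewrite ln_gt0 // ltr1n.
have lnn := ln_gt0 n1.
rewrite /log2 mulrA ler_pdivrMr // => lek.
have k0 : (0 < k)%N.
  rewrite -(ltr0n R) -(pmulr_lgt0 _ ln2); apply: lt_le_trans lek.
  by rewrite mulr_gt0 // addr_gt0.
rewrite ger0_norm ?subr_ge0 ?max_expected_correct_ge1 // lerBlDl.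
apply: le_trans (max_expected_correct_le R n k0) _.
rewrite lerD2l -mulrA ler_wpM2l //.
have n0 : 0 < n.+2%:R :> R by rewrite ltr0n.
(* After logarithms the goal n^2 4^-k <= n^(-2 eps) reads 2 ln n - 2 k ln 2 <= -2 eps ln n, which is
   twice the hypothesis on [k]. *)
rewrite /powR gt_eqF // -[leLHS]lnK; last first.
  by rewrite posrE mulr_gt0 ?exprn_gt0 ?invr_gt0 ?ltr0n.
rewrite ler_expR lnM ?posrE ?exprn_gt0 ?invr_gt0 ?ltr0n //.
rewrite !lnXn ?invr_gt0 ?ltr0n // lnV ?posrE ?ltr0n //.
have -> : 4 = 2 ^+ 2 :> R by rewrite expr2 -natrM.
rewrite lnXn ?ltr0n //.
rewrite -[_ *+ k]mulr_natl.
move: (ln n.+2%:R) (ln 2) (k%:R) lek => L l K lek; lra.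
Qed.
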